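(* Let $\lambda$ be a nonzero real number and let $r\ge 0$ be an integer. For all integers $n,k$ with $n\ge k\ge 0$, $${n+r \brace k+r}_{r,\lambda}=\sum_{l=k}^{n}\binom{n}{l}{l \brace k}_{\lambda}r^{n-l}.$$
   Context: For a nonzero real $\lambda$, the generalized falling factorials are $(x)_{0,\lambda}=1$ and $(x)_{n,\lambda}=x(x-\lambda)\cdots(x-(n-1)\lambda)$ for $n\ge 1$. The $\lambda$-analogues of Stirling numbers of the second kind ${n \brace k}_{\lambda}$ and, for an integer $r\ge 0$, the $\lambda$-analogues of $r$-Stirling numbers of the second kind ${n+r \brace k+r}_{r,\lambda}$ ($0\le k\le n$) are the real numbers uniquely determined by the polynomial identities in $x$ $$x^{n}=\sum_{k=0}^{n}{n \brace k}_{\lambda}(x)_{k,\lambda},\qquad (x+r)^{n}=\sum_{k=0}^{n}{n+r \brace k+r}_{r,\lambda}(x)_{k,\lambda},\quad n\ge 0.$$ Convention: $0^0=1$. *)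

(* Defs.v *)
From HB Require Import structures.
From mathcomp Require Import all_boot all_order all_algebra.
From mathcomp Require Import boolp classical_sets reals.

Set Implicit Arguments.
Unset Strict Implicit.
Unset Printing Implicit Defensive.

Import Order.TTheory GRing.Theory Num.Theory.
Local Open Scope ring_scope.

(* (x)_{n,lam} = x (x - lam) ... (x - (n-1) lam), as a polynomial in x *)
Definition gffact (R : realType) (lam : R) (n : nat) : {poly R} :=
  \prod_(i < n) ('X - (i%:R * lam)%:P).

(* The family c, set to 0 above n so as to be uniquely determined, gives the
   coordinates of p in the basis (x)_{0,lam}, ..., (x)_{n,lam}. *)
Definition gffact_coords (R : realType) (lam : R) (n : nat) (p : {poly R})
    (c : nat -> R) : Prop :=
  p = \sum_(0 <= k < n.+1) c k *: gffact lam k /\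
  (forall k, (n < k)%N -> c k = 0).

Lemma size_gffact (R : realType) (lam : R) n : size (gffact lam n) = n.+1.
Proof.
rewrite /gffact -(big_mkord xpredT (fun i => 'X - (i%:R * lam)%:P)).
by rewrite size_prod_XsubC size_iota subn0.
Qed.

Lemma monic_gffact (R : realType) (lam : R) n : gffact lam n \is monic.
Proof. exact: monic_prod_XsubC. Qed.

Lemma gffact_coords_ex (R : realType) (lam : R) n (p : {poly R}) :
  (size p <= n.+1)%N -> exists c, gffact_coords lam n p c.
Proof.
elim: n p => [|n IHn] p sp.
  exists (fun k => if k == 0%N then p`_0 else 0); split; last by case.
  by rewrite big_nat1 /gffact big_ord0 alg_polyC; apply: size1_polyC.
pose q := p - p`_n.+1 *: gffact lam n.+1.
have /IHn[c [qE c0]] : (size q <= n.+1)%N.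
  apply/leq_sizeP => j; rewrite leq_eqVlt => /predU1P[<-|ltj].
    have /monicP := monic_gffact lam n.+1.
    by rewrite lead_coefE size_gffact /= coefB coefZ => ->; rewrite mulr1 subrr.
  rewrite coefB coefZ [p`_j]nth_default ?(leq_trans sp)//.
  by rewrite [(gffact _ _)`_j]nth_default ?size_gffact// mulr0 subrr.
exists (fun k => if k == n.+1 then p`_n.+1 else c k); split; last first.
  by move=> k ltk; rewrite gtn_eqF// c0// ltnW.
rewrite big_nat_recr//= eqxx; apply/eqP; rewrite -subr_eq; apply/eqP.
rewrite -/q qE; apply: eq_big_nat => k /andP[_ ltk].
by rewrite ltn_eqF.
Qed.

Lemma gffact_coords_uniq (R : realType) (lam : R) n (p : {poly R}) c d :
  gffact_coords lam n p c -> gffact_coords lam n p d -> c = d.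
Proof.
move=> [pc c0] [pd d0]; apply/funext => k.
have [ltk|lekn] := ltnP n k; first by rewrite c0 ?d0.
have : \sum_(0 <= k < n.+1) (c k - d k) *: gffact lam k = 0.
  under eq_bigr do rewrite scalerBl.
  by rewrite sumrB -pc -pd subrr.
apply: contra_eq; rewrite -subr_eq0 => nz_k.
have ex_m : exists m, (m <= n)%N && (c m - d m != 0).
  by exists k; rewrite lekn.
have [//|m /andP[lemn nzm] maxm] := ex_maxnP ex_m (m := n).
  by move=> i /andP[].
apply/eqP => /(congr1 (fun q : {poly R} => q`_m)).
rewrite coef0 coef_sum big_mkord (bigD1 (Ordinal (lemn : (m < n.+1)%N)))//=.
rewrite big1 ?addr0 => [|[i /= lei] neqi].
  have /monicP := monic_gffact lam m.
  rewrite lead_coefE size_gffact /= coefZ => ->; rewrite mulr1 => /eqP.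
  by rewrite (negPf nzm).
rewrite coefZ; have [ltim|lemi] := ltnP i m.
  by rewrite [(gffact _ _)`_m]nth_default ?size_gffact ?mulr0.
have [->|nzi] := eqVneq (c i - d i) 0; first by rewrite mul0r.
have leim : (i <= m)%N by apply: maxm; rewrite -ltnS lei.
by move: neqi; rewrite -val_eqE /= eqn_leq leim lemi.
Qed.

(* Both values below are unique choices, by [gffact_coords_ex] and
   [gffact_coords_uniq]: the default value of [xget] is never reached. *)
Definition lstirling2 (R : realType) (lam : R) (n : nat) : nat -> R :=
  xget (fun=> 0) [set c | gffact_coords lam n 'X^n c]%classic.

(* [rlstirling2 r lam n k] is the number written {n+r brace k+r}_{r,lam}: the
   arguments are n and k, not n+r and k+r. *)
Definition rlstirling2 (R : realType) (r : nat) (lam : R) (n : nat) : nat -> R :=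
  xget (fun=> 0) [set c | gffact_coords lam n (('X + r%:R%:P) ^+ n) c]%classic.

Lemma lstirling2P (R : realType) (lam : R) n :
  gffact_coords lam n 'X^n (lstirling2 lam n).
Proof.
have ex := gffact_coords_ex lam (eq_leq (size_polyXn R n)).
exact: (xgetPex (fun=> 0) ex).
Qed.

Lemma rlstirling2P (R : realType) (r : nat) (lam : R) n :
  gffact_coords lam n (('X + r%:R%:P) ^+ n) (rlstirling2 r lam n).
Proof.
have sz : (size (('X + r%:R%:P : {poly R}) ^+ n) <= n.+1)%N.
  by rewrite (leq_trans (size_poly_exp_leq _ _))// size_XaddC mul1n.
exact: (xgetPex (fun=> 0) (gffact_coords_ex lam sz)).
Qed.

(* Main.v *)
(* Expand (x + r)^n by the binomial theorem and each x^l in the basis (x)_{k,lam}: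
   the claim follows by comparing coordinates. *)
Require Import Defs.
From mathcomp Require Import all_boot all_order all_algebra.
From mathcomp Require Import reals.

Set Implicit Arguments.
Unset Strict Implicit.
Unset Printing Implicit Defensive.

Import Order.TTheory GRing.Theory Num.Theory.
Local Open Scope ring_scope.

(** Coordinates in the basis [gffact lam 0], ..., [gffact lam n] depend linearly on the polynomial
    ([gffact_coords_sum]). The power ['X^l] is only known in the basis up to [l]; padding by zeros
    ([gffact_coords_widen]) brings all [l <= n] into one basis. The binomial expansion then gives
    coordinates of [('X + r%:R%:P) ^+ n], and [gffact_coords_uniq] identifies them with
    [rlstirling2]. *)

Lemma gffact_coords_widen (R : realType) (lam : R) m n (p : {poly R}) c :
  (m <= n)%N -> gffact_coords lam m p c -> gffact_coords lam n p c.
Proof.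
move=> lemn [pE c0]; split=> [|k ltnk]; last by rewrite c0// (leq_ltn_trans lemn).
rewrite pE [RHS](@big_cat_nat _ _ _ m.+1)//=.
rewrite [X in _ = _ + X]big_nat_cond [X in _ = _ + X]big1 ?addr0//.
by move=> k /andP[/andP[ltmk _] _]; rewrite c0// scale0r.
Qed.

Lemma gffact_coords_sum (R : realType) (lam : R) n (I : Type) (s : seq I)
    (a : I -> R) (p : I -> {poly R}) (c : I -> nat -> R) :
  (forall i, gffact_coords lam n (p i) (c i)) ->
  gffact_coords lam n (\sum_(i <- s) a i *: p i)
    (fun k => \sum_(i <- s) a i * c i k).
Proof.
move=> pc; split=> [|k ltnk]; last first.
  by rewrite big1// => i _; rewrite (pc i).2// mulr0.
under [RHS]eq_bigr do rewrite scaler_suml.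
rewrite exchange_big /=; apply: eq_bigr => i _.
rewrite {1}(pc i).1 scaler_sumr; apply: eq_bigr => k _.
by rewrite scalerA.
Qed.

Theorem theorem3 (R : realType) (lam : R) (hlam : lam != 0) (r n k : nat)
    (hkn : (k <= n)%N) :
  rlstirling2 r lam n k =
    \sum_(k <= l < n.+1) ('C(n, l))%:R * lstirling2 lam l k * r%:R ^+ (n - l).
Proof.
have Xc (l : 'I_n.+1) : gffact_coords lam n 'X^l (lstirling2 lam l).
  by apply: gffact_coords_widen (lstirling2P lam l); rewrite -ltnS.
have := gffact_coords_sum (index_enum 'I_n.+1)
  (fun l : 'I_n.+1 => 'C(n, l)%:R * r%:R ^+ (n - l)) Xc.
have -> : \sum_(l < n.+1) ('C(n, l)%:R * r%:R ^+ (n - l)) *: 'X^l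
    = ('X + r%:R%:P) ^+ n :> {poly R}.
  (* Swapping the summands makes [exprDn] put the exponent [l] on ['X] and [n - l] on the
     constant. *)
  rewrite addrC exprDn; apply: eq_bigr => l _.
  by rewrite -scalerA scaler_nat -polyC_exp mul_polyC.
move=> /(gffact_coords_uniq (rlstirling2P r lam n)) ->.
rewrite -(big_mkord xpredT
  (fun l => 'C(n, l)%:R * r%:R ^+ (n - l) * lstirling2 lam l k)).
(* The sum starts at [l = 0]; its terms with [l < k] vanish because the coordinates of ['X^l] are
   zero beyond index [l]. *)
rewrite (@big_cat_nat _ _ _ k)//= ?(leqW hkn)// big_nat_cond big1 ?add0r.
  by apply: eq_bigr => l _; rewrite mulrAC.
move=> l /andP[/andP[_ ltlk] _].
by rewrite (lstirling2P lam l).2// mulr0.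
Qed.
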